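(* Let $K$ be a field of prime characteristic and let $L/K$ be a finite field extension. Then the following statements are equivalent: 1. $\mathcal{D}(L/K)=E(L/K)$, i.e. $L/K$ is a B-extension with $\mathcal{D}(L/K)=E(L/K)$. 2. $L_{dif}=K$. 3. $L^{G(L/K)}=L$ and $L/K$ is a B-extension. 4. $G(L/K)=\{e\}$ and $L/K$ is a B-extension. 5. $L^{pi}=L$.
   Context: For a finite field extension $L/K$: $E(L/K)=\mathrm{End}_K(L)$; $L$ is viewed as a subfield of $E(L/K)$ via multiplication operators. $G(L/K)=\mathrm{Aut}_{K\text{-alg}}(L)\subseteq E(L/K)$, with identity element $e$, and $L^{G(L/K)}$ is its fixed field. $\mathcal{D}(L/K)=\bigcup_{i\ge0}\mathcal{D}_i\subseteq E(L/K)$ is the algebra of $K$-linear differential operators on $L$, where $\mathcal{D}_0=L$ and $\mathcal{D}_i=\{\delta\in E(L/K)\mid\delta l-l\delta\in\mathcal{D}_{i-1}\text{ for all }l\in L\}$. $L_{dif}=\{l\in L\mid l\delta=\delta l\text{ for all }\delta\in\mathcal{D}(L/K)\}$. $L^{pi}$ is the largest purely inseparable subfield of $L/K$. $L/K$ is called a B-extension if $E(L/K)=\mathcal{D}(L/K)\rtimes G(L/K)$, where $\mathcal{D}(L/K)\rtimes G(L/K)=\bigoplus_{g\in G(L/K)}\mathcal{D}(L/K)g$ is the subalgebra of $E(L/K)$ generated by $\mathcal{D}(L/K)$ and $G(L/K)$. *)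

(* Defs.v *)
From HB Require Import structures.
From mathcomp Require Import all_boot all_order all_algebra all_field.
From mathcomp Require Import boolp classical_sets.

Set Implicit Arguments.
Unset Strict Implicit.
Unset Printing Implicit Defensive.

Import GRing.Theory.
Local Open Scope ring_scope.
Local Open Scope classical_set_scope.

(* Throughout, E(L/K) is 'End(L), whose product is the composition \o of
   linear functions; K is identified with the subspace 1%VS of L, and l : L
   with the multiplication operator amull l. *)

Section FieldExtension.
Variables (K : fieldType) (L : fieldExtType K).

Fixpoint diffop_le (i : nat) : set 'End(L) :=
  if i is j.+1 then
    [set d | forall l : L,
       diffop_le j ((d \o amull l)%VF - (amull l \o d)%VF)]
  else range (@amull K L).

Definition diffop : set 'End(L) := \bigcup_i diffop_le i.

Definition galG : set 'End(L) := [set g | kAut 1%VS {:L}%VS g].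

Definition fixedG : set L := [set l | forall g, galG g -> g l = l].

Definition Ldif : set L :=
  [set l | forall d, diffop d -> (amull l \o d)%VF = (d \o amull l)%VF].

(* The sum of the subspaces D(L/K) g, for g in G(L/K). A finite subset of
   G(L/K) is given by its duplicate-free enumeration gs. *)
Definition diffopG : set 'End(L) :=
  [set f | exists (gs : seq 'End(L)) (d : 'End(L) -> 'End(L)),
     [/\ uniq gs, {in gs, forall g, galG g}, {in gs, forall g, diffop (d g)}
       & f = \sum_(g <- gs) (d g \o g)%VF]].

(* As each g is invertible, d g \o g = 0 amounts to d g = 0. *)
Definition diffopG_direct : Prop :=
  forall (gs : seq 'End(L)) (d : 'End(L) -> 'End(L)),
    uniq gs -> {in gs, forall g, galG g} -> {in gs, forall g, diffop (d g)} ->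
    \sum_(g <- gs) (d g \o g)%VF = 0 -> {in gs, forall g, (d g \o g)%VF = 0}.

Definition B_extension : Prop :=
  diffopG_direct /\ diffopG = [set: 'End(L)].

Definition largest_insep (M : {subfield L}) : Prop :=
  purely_inseparable 1 M /\
  forall N : {subfield L}, purely_inseparable 1 N -> (N <= M)%VS.

Lemma largest_insep_exists : exists M : {subfield L}, largest_insep M.
Proof.
suff ex n (M : {subfield L}) : purely_inseparable 1 M ->
    (\dim {:L} - \dim M < n)%N -> exists M : {subfield L}, largest_insep M.
  exact: (ex _ 1%AS (purely_inseparable_refl 1%AS) (ltnSn _)).
elim: n M => // n IHn M piM leMn.
have [?|nmax] := pselect (largest_insep M); first by exists M.
have [N piN /subvPn[x Nx M'x]] : exists2 N : {subfield L},
    purely_inseparable 1 N & ~~ (N <= M)%VS.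
  apply: contrapT => noN; apply: nmax; split=> // N piN.
  by apply: contrapT => /negP nNM; apply: noN; exists N.
have pix : purely_inseparable_element 1 x.
  exact: (purely_inseparableP (K := 1%AS) piN).
have /purely_inseparable_elementP_pchar[m pcharm xm] :=
  sub_inseparable (K := 1%AS) (sub1v M) pix.
have piMx : purely_inseparable M <<M; x>>%VS.
  apply/purely_inseparableP => y /Fadjoin_polyP[q /polyOverP Mq ->].
  rewrite horner_coef; apply: inseparable_sum => i _.
  apply/purely_inseparable_elementP_pchar; exists m => //.
  by rewrite exprMn exprAC; apply: rpredM; apply: rpredX => //; apply: Mq.
apply: (IHn <<M; x>>%AS).
  exact: (purely_inseparable_trans (K := 1%AS) piM piMx).
have ltM : (\dim M < \dim <<M; x>>)%N.
  rewrite ltn_neqAle dimvS ?subv_adjoin // andbT.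
  apply: contra M'x => /eqP eqM.
  have /eqP-> : M == <<M; x>>%VS :> {vspace L}.
    by rewrite eqEdim subv_adjoin eqM /=.
  exact: memv_adjoin.
have leMx := dimvS (subvf <<M; x>>%VS).
rewrite -ltnS; apply: leq_trans leMn; rewrite ltnS ltn_sub2l //.
exact: leq_trans ltM leMx.
Qed.

Definition Lpi : {subfield L} := projT1 (cid largest_insep_exists).

Lemma LpiP : largest_insep Lpi.
Proof. exact: projT2 (cid largest_insep_exists). Qed.

End FieldExtension.

Arguments diffop {K} L.
Arguments galG {K} L.
Arguments fixedG {K} L.
Arguments Ldif {K} L.
Arguments B_extension {K} L.
Arguments Lpi {K} L.

(* Main.v *)
(* Write [ad l d] for the commutator d l - l d. Since d |-> d l and d |-> l d
   commute, ad l ^ q = ad (l ^ q) for q a power of the characteristic, and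
   differential operators are killed by large iterates of ad l. Hence every
   differential operator commutes with x ^ q for q large, and so with x itself
   if x is separable over K, since then K(x) = K(x ^ q). Therefore L_dif = K
   forces L/K to be purely inseparable. Conversely, if L/K is purely
   inseparable, then every ad l is nilpotent on E(L/K), and expanding iterated
   commutators along a basis of L shows E(L/K) = D(L/K). Finally, a purely
   inseparable extension has no nontrivial automorphism, and D(L/K) x G(L/K)
   is just D(L/K) when G(L/K) is trivial. *)
Require Import Defs.
From HB Require Import structures.
From mathcomp Require Import all_boot all_order all_algebra all_field.
From mathcomp Require Import boolp classical_sets.

Import GRing.Theory.
Local Open Scope ring_scope.
Local Open Scope classical_set_scope.

Section Commutators.
Set Implicit Arguments.
Unset Strict Implicit.
Variables (K : fieldType) (L : fieldExtType K).
Implicit Types (d f g : 'End(L)) (l x y : L).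

Definition ad l d : 'End(L) := (d \o amull l)%VF - (amull l \o d)%VF.

Lemma adE l d x : ad l d x = d (l * x) - l * d x.
Proof. by rewrite !lfunE /= opp_lfunE !comp_lfunE !lfunE. Qed.

Lemma lincomb_lfunE (k : K) f g x : (k *: f + g) x = k *: f x + g x.
Proof. by rewrite !lfunE /= lfunE. Qed.

Lemma ad_is_linear l : linear (ad l).
Proof.
move=> k f g; apply/lfunP => x.
by rewrite adE !lincomb_lfunE !adE mulrDr scalerBr scalerAr opprD addrACA.
Qed.

HB.instance Definition _ l :=
  GRing.isLinear.Build K 'End(L) 'End(L) _ (ad l) (ad_is_linear l).

(** K-linearity in the multiplier: commutators with arbitrary elements of L reduce to those with a
    basis. *)
Lemma ad_suml I (r : seq I) (c : I -> K) (e : I -> L) d :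
  ad (\sum_(i <- r) c i *: e i) d = \sum_(i <- r) c i *: ad (e i) d.
Proof.
apply/lfunP => x; rewrite adE sum_lfunE !mulr_suml linear_sum -sumrB.
apply: eq_bigr => i _.
by rewrite lfunE /= adE -!scalerAl linearZ -scalerBr.
Qed.

Lemma ad_comm x y d : ad x (ad y d) = ad y (ad x d).
Proof.
apply/lfunP => z; rewrite !adE !mulrBr [y * (x * z)]mulrCA [x * (y * d z)]mulrCA.
by rewrite !opprB addrACA [RHS]addrACA; congr (_ + _); rewrite addrC.
Qed.

Lemma iter_ad_comm n x y d : iter n (ad x) (ad y d) = ad y (iter n (ad x) d).
Proof. by elim: n => //= n ->; rewrite ad_comm. Qed.

Lemma iter_ad0 n x : iter n (ad x) 0 = 0.
Proof. by elim: n => //= n ->; rewrite linear0. Qed.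

Lemma iter_ad_eq0 m n x d : (m <= n)%N ->
  iter m (ad x) d = 0 -> iter n (ad x) d = 0.
Proof. by move=> /subnK <- d0; rewrite iterD d0 iter_ad0. Qed.

(* Right multiplication by l plays the role of the indeterminate of {poly L}. *)
Lemma iter_adE n l d x :
  iter n (ad l) d x =
    \sum_(i < n.+1) (('X - l%:P) ^+ n)`_i * d (l ^+ i * x).
Proof.
elim: n x => [|n IHn] x /=.
  by rewrite big_ord_recl big_ord0 addr0 expr0 coef1 !mul1r.
rewrite adE !IHn; set P := _ ^+ n; rewrite [_ ^+ n.+1]exprS -/P mulrBl.
under [in RHS]eq_bigr do rewrite coefB coefXM coefCM mulrBl.
rewrite sumrB; congr (_ - _).
  rewrite [RHS]big_ord_recl mul0r add0r.
  by apply: eq_bigr => i _; rewrite /bump /= exprSr mulrA.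
(* [P] has degree at most n, so its coefficient of index [n.+1] vanishes. *)
rewrite [RHS]big_ord_recr /= [P`_n.+1]nth_default; last first.
  by rewrite (leq_trans (size_poly_exp_leq _ _)) // size_XsubC mul1n.
by rewrite mulr0 mul0r addr0 mulr_sumr; apply: eq_bigr => i _; rewrite mulrA.
Qed.

Lemma iter_ad_pchar n l d : [pchar L].-nat n ->
  iter n (ad l) d = ad (l ^+ n) d.
Proof.
move=> charn; have n_gt0 : (0 < n)%N by case/andP: charn.
apply/lfunP => x; rewrite iter_adE adE.
(* By additivity of Frobenius only the terms of index 0 and n survive in the expansion of the
   iterate. *)
have -> : ('X - l%:P) ^+ n = 'X^n - (l ^+ n)%:P.
  have charPn : [pchar {poly L}].-nat n by rewrite (eq_pnat _ (pchar_poly L)).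
  apply/(addIr (l%:P ^+ n)).
  by rewrite -exprDn_pchar // subrK polyC_exp subrK.
under eq_bigr do rewrite coefB coefXn coefC mulrBl.
rewrite sumrB; congr (_ - _).
  rewrite big_ord_recr /= eqxx mul1r big1 ?add0r // => i _.
  by rewrite ltn_eqF // mul0r.
by rewrite big_ord_recl /= expr0 mul1r big1 ?addr0 // => i _; rewrite mul0r.
Qed.

Lemma ad_eq0 l d : (ad l d = 0) <-> (amull l \o d)%VF = (d \o amull l)%VF.
Proof. by rewrite /ad; split=> [/eqP|->]; rewrite ?subrr // subr_eq0 => /eqP. Qed.

Lemma ad_scalar l d : l \in 1%VS -> ad l d = 0.
Proof.
case/vlineP => k ->; apply/lfunP => x.
by rewrite adE -!scalerAl !mul1r linearZ subrr lfunE.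
Qed.

(** Elements of K(y) are polynomials in y over K, and d is K-linear and commutes with the powers of
    y. *)
Lemma ad_adjoin x y d : x \in <<1; y>>%VS -> ad y d = 0 -> ad x d = 0.
Proof.
move=> /(Fadjoin_polyP (K := 1%AS))[q Kq ->] ady0.
have dy z : d (y * z) = y * d z.
  by apply/eqP; rewrite -subr_eq0 -adE ady0 lfunE.
have dyn n z : d (y ^+ n * z) = y ^+ n * d z.
  elim: n z => [|n IHn] z; first by rewrite !mul1r.
  by rewrite exprS -!mulrA dy IHn.
apply/lfunP => z; rewrite adE lfunE horner_coef !mulr_suml linear_sum -sumrB.
apply: big1 => i _.
have /vlineP[k ->] := polyOverP Kq i.
by rewrite -!scalerAl !mul1r linearZ /= dyn subrr.
Qed.

(** Each commutator lowers the order by one; the last of the [i.+1] kills the multiplication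
    operator left at order 0. *)
Lemma iter_ad_diffop_le i d l : diffop_le i d -> iter i.+1 (ad l) d = 0.
Proof.
elim: i d => [d [a _ <-]|i IHi d Dd]; last by rewrite iterSr; apply/IHi/Dd.
by apply/lfunP => x; rewrite adE !lfunE /= mulrCA subrr.
Qed.

Lemma diffop_le0 i : diffop_le i (0 : 'End(L)).
Proof.
elim: i => [|i IHi]; first by exists 0; rewrite ?linear0.
by move=> l; have := linear0 (ad l) => /= adl0; rewrite -/(ad l 0) adl0.
Qed.

Lemma diffop_leP i k f g :
  diffop_le i f -> diffop_le i g -> diffop_le i (k *: f + g).
Proof.
elim: i f g => [|i IHi] f g.
  by move=> [a _ <-] [b _ <-]; exists (k *: a + b); rewrite ?linearP.
by move=> Df Dg l; rewrite -/(ad l _) linearP; apply: IHi; [apply: Df | apply: Dg].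
Qed.

Lemma diffop_le_sum i (I : Type) (r : seq I) (c : I -> K) (f : I -> 'End(L)) :
  (forall j, diffop_le i (f j)) -> diffop_le i (\sum_(j <- r) c j *: f j).
Proof.
move=> Df; elim: r => [|j r IHr]; first by rewrite big_nil; apply: diffop_le0.
by rewrite big_cons; apply: diffop_leP.
Qed.

(* [ad l f] is a linear combination of the [ad e`_j f], and each of them lowers
   one of the exponents m j. *)
Lemma diffop_le_nilpotent n (e : n.-tuple L) (m : 'I_n -> nat) f :
    basis_of {:L} e -> (forall j, iter (m j) (ad e`_j) f = 0) ->
  diffop_le (\sum_j m j) f.
Proof.
move=> e_basis; have n_gt0 : (0 < n)%N.
  rewrite -(size_basis e_basis).
  by rewrite (leq_trans _ (dimvS (sub1v {:L}%AS))) // dimv1.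
have [s sum_m] : {s | (\sum_j m j)%N = s} by exists (\sum_j m j)%N.
rewrite sum_m; elim: s m f sum_m => [|s IHs] m f sum_m fm.
  (* All exponents are 0, and as the basis is nonempty one of the hypotheses reads f = 0. *)
  have /eqP := sum_m; rewrite sum_nat_eq0 => /forallP/(_ (Ordinal n_gt0))/eqP m0.
  have := fm (Ordinal n_gt0); rewrite m0 => f0.
  by rewrite [f]f0; apply: diffop_le0.
move=> l; rewrite -/(ad l f) (coord_basis e_basis (memvf l)) ad_suml.
apply: diffop_le_sum => j; case mj: (m j) => [|k].
  have := fm j; rewrite mj => f0.
  by rewrite [f]f0 linear0; apply: diffop_le0.
apply: (IHs (fun i => if i == j then k else m i)) => [|i].
  apply: succn_inj; rewrite -sum_m (bigD1 j) //= [RHS](bigD1 j) //= eqxx mj addSn.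
  by congr (_ + _).+1; apply: eq_bigr => i /negPf->.
case: eqP => [->|_]; first by rewrite -iterSr -mj.
by rewrite iter_ad_comm fm linear0.
Qed.

End Commutators.

Section PurelyInseparable.
Set Implicit Arguments.
Unset Strict Implicit.
Variables (K : fieldType) (L : fieldExtType K).

Lemma Lpi_eq_fullv :
  (Lpi L : {vspace L}) = {:L}%VS <-> purely_inseparable 1 {:L}.
Proof.
have [piM maxM] := LpiP L; split=> [<- //|piL].
by apply/eqP; rewrite eqEsubv subvf; apply: (maxM {:L}%AS).
Qed.

Lemma separable_Ldif p x : p \in [pchar L] ->
  separable_element 1 x -> Ldif L x.
Proof.
move=> charLp sepx d [i _ Dd]; apply/ad_eq0.
(* Separability puts x in K(x ^ q) with q = p ^ (i + 1). This q is at least i + 1, enough iterations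
   to kill an operator of order i. *)
move: sepx; rewrite (pcharf_p_separable 1%AS x i charLp) => /ad_adjoin; apply.
have charpi : [pchar L].-nat (p ^ i.+1)%N.
  by rewrite pnatX pnatE ?charLp // (pcharf_prime charLp).
rewrite -iter_ad_pchar //; apply: iter_ad_eq0 (iter_ad_diffop_le x Dd).
by rewrite ltnW // ltn_expl // prime_gt1 // (pcharf_prime charLp).
Qed.

Lemma Ldif_purely_inseparable p : p \in [pchar L] ->
  Ldif L `<=` [set x | x \in 1%VS] -> purely_inseparable 1 {:L}.
Proof.
move=> charLp LdifK; apply/(purely_inseparableP (K := 1%AS)) => x _.
(* Some x ^ n, with n a power of the characteristic, is separable over K, hence lies in [Ldif L] and
   so in K. *)
have [n /andP[charn sepx]] := separable_exponent_pchar 1%AS x.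
apply/(purely_inseparable_elementP_pchar (K := 1%AS)); exists n => //.
exact: LdifK (separable_Ldif charLp sepx).
Qed.

Lemma purely_inseparable_diffop :
  purely_inseparable 1 {:L} -> diffop L = [set: 'End(L)].
Proof.
move=> piL; apply/seteqP; split=> // f _.
pose e := vbasis {:L}.
have /choice[m em0] (j : 'I_(\dim {:L})) :
    exists m, iter m (ad e`_j) f = 0.
  have /(purely_inseparable_elementP_pchar (K := 1%AS))[m charm em] :=
    purely_inseparableP (K := 1%AS) piL e`_j (memvf _).
  (* The m-th iterate is the commutator with the m-th power of the basis vector, which lies in K. *)
  by exists m; rewrite iter_ad_pchar // ad_scalar.
by exists (\sum_j m j)%N => //; apply: (diffop_le_nilpotent (vbasisP _) em0).
Qed.

Lemma diffop_full_Ldif :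
  diffop L = [set: 'End(L)] -> Ldif L = [set x : L | x \in (1%VS : {vspace L})].
Proof.
move=> DE; apply/seteqP; split=> [x xdif|x Kx d _]; last exact/ad_eq0/ad_scalar.
(* Test x against a K-linear projection onto K: evaluating at 1 shows that x equals its own
   projection. *)
have /ad_eq0/lfunP/(_ 1) : (amull x \o projv 1)%VF = (projv 1 \o amull x)%VF.
  by apply: xdif; rewrite DE.
rewrite adE [RHS]lfunE mulr1 [projv _ 1]projv_id ?mem1v // mulr1 => /eqP; rewrite subr_eq0.
by move=> /eqP /= <-; apply: memv_proj.
Qed.

Lemma galG_id : galG L \1%VF.
Proof. by rewrite /galG /= /kAut kHom1 lim1g eqxx. Qed.

Lemma purely_inseparable_galG :
  purely_inseparable 1 {:L} -> galG L = [set \1%VF : 'End(L)].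
Proof.
move=> piL; apply/seteqP; split=> [g|_ -> /=]; last exact: galG_id.
case/andP => /(kHomP_tmp (K := 1%AS))[gK gM] _; apply/lfunP => x.
have /(purely_inseparable_elementP_pchar (K := 1%AS))[n charn xn] :=
  purely_inseparableP (K := 1%AS) piL x (memvf x).
have gX i : g (x ^+ i) = g x ^+ i.
  elim: i => [|i IHi]; first by rewrite !expr0 gK ?mem1v.
  by rewrite !exprS gM ?memvf // IHi.
have n_gt0 : (0 < n)%N by case/andP: charn.
rewrite lfunE /=; apply/eqP; rewrite -subr_eq0.
(* Since x ^ n is in K, (g x - x) ^ n = g (x ^ n) - x ^ n = 0. *)
have := exprDn_pchar (g x - x) x charn; rewrite subrK -gX gK // => /eqP.
by rewrite -subr_eq subrr eq_sym expf_eq0 n_gt0.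
Qed.

Lemma fixedG_full :
  fixedG L = [set: L] <-> galG L = [set \1%VF : 'End(L)].
Proof.
split=> [fixL|galL]; last first.
  by apply/seteqP; split=> // x _ g; rewrite galL => ->; rewrite lfunE.
apply/seteqP; split=> [g Gg|_ -> /=]; last exact: galG_id.
apply/lfunP => x; rewrite lfunE.
by have : fixedG L x by [rewrite fixL]; apply.
Qed.

Lemma diffop0 : diffop L 0.
Proof. by exists 0 => //; apply: diffop_le0. Qed.

Lemma uniq_galG_id (gs : seq 'End(L)) :
    galG L = [set \1%VF : 'End(L)] -> uniq gs -> {in gs, forall g, galG L g} ->
  gs = [::] \/ gs = [:: \1%VF].
Proof.
move=> galL; case: gs => [|g [|h s]]; first by left.
  by move=> _ /(_ g (mem_head _ _)); rewrite galL => ->; right.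
move=> /= /andP[+ _] Ggs; have := Ggs g (mem_head _ _).
have : galG L h by apply: Ggs; rewrite !inE eqxx orbT.
by rewrite galL => -> ->; rewrite inE eqxx.
Qed.

(** Over a trivial group the sum has the single component [diffop L], so directness is automatic. *)
Lemma B_extension_galG1 : galG L = [set \1%VF : 'End(L)] ->
  B_extension L <-> diffop L = [set: 'End(L)].
Proof.
move=> galL; split=> [[_ DG]|DE].
  apply/seteqP; split=> // f _.
  have [gs [d [ugs Ggs Dgs ->]]] : diffopG f by rewrite DG.
  have [gs0|gs1] := uniq_galG_id galL ugs Ggs.
    by rewrite gs0 big_nil; apply: diffop0.
  by rewrite gs1 big_seq1 comp_lfun1r; apply: Dgs; rewrite gs1 mem_head.
split=> [gs d ugs Ggs _|].
  by have [->|->] := uniq_galG_id galL ugs Ggs; rewrite ?big_seq1 // => d0 g;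
    rewrite inE => /eqP->.
apply/seteqP; split=> // f _; exists [:: \1%VF], (fun=> f).
split=> //; last by rewrite big_seq1 comp_lfun1r.
- by move=> g; rewrite inE => /eqP->; apply: galG_id.
- by move=> g _; rewrite DE.
Qed.

End PurelyInseparable.

Theorem corollary6p5 (K : fieldType) (p : nat) (charKp : p \in [pchar K])
    (L : fieldExtType K) :
  [<-> diffop L = [set: 'End(L)];
       B_extension L /\ diffop L = [set: 'End(L)];
       Ldif L = [set x : L | x \in (1%VS : {vspace L})];
       fixedG L = [set: L] /\ B_extension L;
       galG L = [set \1%VF : 'End(L)] /\ B_extension L;
       (Lpi L : {vspace L}) = {:L}%VS].
Proof.
have charLp : p \in [pchar L] by rewrite pchar_lalg.
have dif_pi : Ldif L = [set x : L | x \in (1%VS : {vspace L})] ->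
    purely_inseparable 1 {:L}.
  by move=> LdifK; apply: (Ldif_purely_inseparable charLp); rewrite LdifK.
tfae.
(* Directness comes from the triviality of the group, reached through [Ldif L] = K and pure
   inseparability. *)
- move=> DE; split=> //; apply/B_extension_galG1 => //.
  exact/purely_inseparable_galG/dif_pi/diffop_full_Ldif.
- by case=> _; apply: diffop_full_Ldif.
- move=> /dif_pi piL; have galL := purely_inseparable_galG piL.
  split; first exact/fixedG_full.
  exact/(B_extension_galG1 galL)/purely_inseparable_diffop.
- by case=> /fixedG_full.
- case=> galL /(B_extension_galG1 galL) DE.
  exact/Lpi_eq_fullv/dif_pi/diffop_full_Ldif.
- by move=> /Lpi_eq_fullv; apply: purely_inseparable_diffop.
Qed.
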